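(* Let $\mathbf X=(X_1,\dots,X_M)$ be a random feature vector and $Y$ a class label taking values in the finite set $\{c_1,\dots,c_{n_c}\}$. Let $\mathbf D=(D_{k,l})\in\mathbb R^{n_c\times n_c}$ be the matrix of a ground metric on the classes, and let $W$ denote the Wasserstein distance with cost matrix $\mathbf D$ between probability vectors of length $n_c$. Let $i\in\{1,\dots,M\}$ and let $\mathcal G_i\subseteq\{1,\dots,M\}$ with $i\notin\mathcal G_i$. Then $$p(Y\mid \mathbf X_{\mathcal G_i},X_i)=p(Y\mid \mathbf X_{\mathcal G_i})$$ (that is, $p(Y\mid \mathbf X_{\mathcal G_i}=\mathbf x_{\mathcal G_i},X_i=x_i)=p(Y\mid \mathbf X_{\mathcal G_i}=\mathbf x_{\mathcal G_i})$ for every configuration $(\mathbf x_{\mathcal G_i},x_i)$) if and only if $$W\big[p(Y\mid \mathbf X_{\mathcal G_i}=\mathbf x_{\mathcal G_i},X_i=x_i),\;p(Y\mid \mathbf X_{\mathcal G_i}=\mathbf x_{\mathcal G_i})\big]=0$$ for every configuration $\mathbf X_{\mathcal G_i}=\mathbf x_{\mathcal G_i}$, $X_i=x_i$.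
   Context: For $\theta\subseteq\{1,\dots,M\}$, $\mathbf X_\theta$ denotes the subvector of $\mathbf X$ with coordinates indexed by $\theta$. The conditional distributions of $Y$ are regarded as probability vectors of length $n_c$; for each configuration $(\mathbf x_{\mathcal G_i},x_i)$ under consideration, $p(Y\mid \mathbf X_{\mathcal G_i}=\mathbf x_{\mathcal G_i},X_i=x_i)$ and $p(Y\mid \mathbf X_{\mathcal G_i}=\mathbf x_{\mathcal G_i})$ are given (fixed versions of the) conditional distributions. Wasserstein distance: for probability vectors $\mathbf p,\mathbf q\in\mathbb R^{n_c}$, $$W[\mathbf p,\mathbf q]=\min\Big\{\operatorname{tr}(\mathbf Q^\top\mathbf D)=\sum_{k,l}Q_{k,l}D_{k,l}\;:\;\mathbf Q\in\mathbb R^{n_c\times n_c},\ \mathbf Q\mathbf 1=\mathbf p,\ \mathbf Q^\top\mathbf 1=\mathbf q,\ Q_{k,l}\ge 0\ \forall k,l\Big\}.$$ Ground metric: $D_{k,l}=d(c_k,c_l)$ where $d$ is a metric on $\{c_1,\dots,c_{n_c}\}$; in particular $D_{k,k}=0$ and $D_{k,l}>0$ for $k\neq l$. *)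

(* Defs.v *)
From HB Require Import structures.
From mathcomp Require Import all_boot all_order all_algebra.
From mathcomp Require Import all_classical all_reals all_analysis.
Set Implicit Arguments.
Unset Strict Implicit.
Unset Printing Implicit Defensive.
Import Order.TTheory GRing.Theory Num.Theory.
Import numFieldNormedType.Exports.
Local Open Scope classical_set_scope.
Local Open Scope ring_scope.

(* The class c_k is represented by its index k : 'I_n, where n is the number
   of classes; probability vectors on the classes are column vectors. *)

Section wasserstein.
Context {R : realType} {n : nat}.
Implicit Types (D Q : 'M[R]_n) (p q : 'cV[R]_n).

Definition prob_vector p : Prop :=
  (forall k, 0 <= p k 0) /\ \sum_k p k 0 = 1.

Definition ground_metric D : Prop :=
  [/\ forall k l, 0 <= D k l,
      forall k l, D k l = 0 <-> k = l,
      forall k l, D k l = D l k &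
      forall j k l, D j l <= D j k + D k l].

Definition coupling p q Q : Prop :=
  [/\ Q *m const_mx 1 = p, Q^T *m const_mx 1 = q & forall k l, 0 <= Q k l].

(* By wasserstein_min below, the infimum is a minimum when p and q are
   probability vectors; nothing is meant by the value for other p and q. *)
Definition wasserstein D p q : R :=
  inf [set \tr (Q^T *m D) | Q in coupling p q].

Lemma coupling_row p q Q k : coupling p q Q -> \sum_l Q k l = p k 0.
Proof.
by case=> <- _ _; rewrite mxE; apply: eq_bigr => l _; rewrite mxE mulr1.
Qed.

Lemma coupling_indep p q : prob_vector p -> prob_vector q ->
  coupling p q (p *m q^T).
Proof.
move=> [p0 p1] [q0 q1]; split.
- rewrite -mulmxA; apply/matrixP => k j; rewrite !mxE big_ord1 !mxE.
  rewrite (eq_bigr (fun l => q l 0)) ?q1 ?mulr1 ?(ord1 j)//.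
  by move=> l _; rewrite !mxE mulr1.
- rewrite trmx_mul trmxK -mulmxA; apply/matrixP => k j.
  rewrite !mxE big_ord1 !mxE.
  rewrite (eq_bigr (fun l => p l 0)) ?p1 ?mulr1 ?(ord1 j)//.
  by move=> l _; rewrite !mxE mulr1.
- by move=> k l; rewrite !mxE big_ord1 mxE mulr_ge0.
Qed.

Lemma cost_sum D Q : \tr (Q^T *m D) = \sum_k \sum_l Q k l * D k l.
Proof.
rewrite exchange_big /=; apply: eq_bigr => l _; rewrite mxE.
by apply: eq_bigr => k _; rewrite mxE.
Qed.

Let continuous_bigsum (T : topologicalType) (I : Type) (r : seq I)
    (f : I -> T -> R) :
  (forall i, continuous (f i)) -> continuous (fun x => \sum_(i <- r) f i x).
Proof.
move=> cf; elim: r => [|i r IH].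
  have -> : (fun x => \sum_(i <- [::]) f i x) = fun=> 0.
    by apply/funext => x; rewrite big_nil.
  by move=> x; exact: cvg_cst.
have -> : (fun x => \sum_(j <- i :: r) f j x) =
    fun x => f i x + \sum_(j <- r) f j x.
  by apply/funext => x; rewrite big_cons.
by move=> x; apply: cvgD; [exact: cf|exact: IH].
Qed.

Let continuous_entry k l : continuous (fun v : 'rV[R]_(n * n) => vec_mx v k l).
Proof.
have -> : (fun v : 'rV[R]_(n * n) => vec_mx v k l) =
    (fun v => v ord0 (mxvec_index k l)) by apply/funext => v; rewrite mxE.
exact: coord_continuous.
Qed.

Lemma wasserstein_min D p q : prob_vector p -> prob_vector q ->
  (exists2 Q, coupling p q Q & \tr (Q^T *m D) = wasserstein D p q) /\
  (forall Q, coupling p q Q -> wasserstein D p q <= \tr (Q^T *m D)).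
Proof.
move=> pp qq.
pose f (v : 'rV[R]_(n * n)) := \tr ((vec_mx v)^T *m D).
pose A := [set v : 'rV[R]_(n * n) | coupling p q (vec_mx v)].
have A0 : A !=set0.
  by exists (mxvec (p *m q^T)); rewrite /A /= mxvecK; exact: coupling_indep.
have fc : continuous f.
  have -> : f = fun v => \sum_k \sum_l vec_mx v k l * D k l.
    by apply/funext => v; rewrite /f cost_sum.
  apply: continuous_bigsum => k; apply: continuous_bigsum => l x.
  exact: (cvgM (@continuous_entry k l x) (cvg_cst (D k l))).
have Acl : closed A.
  have -> : A = \bigcap_k ((fun v => \sum_l vec_mx v k l) @^-1` [set p k 0]) `&`
      \bigcap_l ((fun v => \sum_k vec_mx v k l) @^-1` [set q l 0]) `&`
      \bigcap_kl ((fun v => vec_mx v kl.1 kl.2) @^-1` [set x | 0 <= x]).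
    apply/seteqP; split => v.
      move=> cv; split; [split|].
      - by move=> k _ /=; rewrite (coupling_row _ cv).
      - move=> l _ /=; case: cv => _ <- _; rewrite [RHS]mxE.
        by apply: eq_bigr => k _; rewrite !mxE mulr1.
      - by move=> [k l] _ /=; case: cv.
    move=> [[H1 H2] H3]; split.
    - apply/matrixP => k j; rewrite (ord1 j) -(H1 k I) mxE.
      by apply: eq_bigr => l _; rewrite [X in _ * X]mxE mulr1.
    - apply/matrixP => l j; rewrite (ord1 j) -(H2 l I) mxE.
      by apply: eq_bigr => k _; rewrite [X in _ * X]mxE mulr1 mxE.
    - by move=> k l; exact: (H3 (k, l)).
  have clS f' (B : set R) : continuous f' -> closed B ->
      closed ((f' : 'rV[R]_(n * n) -> R) @^-1` B).
    by move=> cf'; apply: preimage_closed => x _; exact: cf'.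
  apply: closedI; [apply: closedI|]; apply: closed_bigI => i _; apply: clS.
  - by apply: continuous_bigsum => l; exact: continuous_entry.
  - exact: closed_eq.
  - by apply: continuous_bigsum => k; exact: continuous_entry.
  - exact: closed_eq.
  - exact: continuous_entry.
  - exact: closed_ge.
have Ac : compact A.
  apply: bounded_closed_compact => //.
  exists 1; split => // x x1 v Av.
  rewrite /= [X in X <= _]mx_normrE; apply: bigmax_le => [|[i j] _ /=].
    by rewrite (le_trans _ (ltW x1)).
  rewrite (ord1 i); have [k l] := mxvec_indexP j.
  have -> : v 0 (mxvec_index k l) = vec_mx v k l by rewrite mxE.
  have [_ _ Q0] := Av.
  rewrite ger0_norm //; apply: le_trans (ltW x1).
  apply: (@le_trans _ _ (\sum_k p k 0)); last by rewrite (proj2 pp).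
  apply: (@le_trans _ _ (p k 0)).
    rewrite -(coupling_row k Av) (bigD1 l) //= lerDl.
    by apply: sumr_ge0.
  rewrite (bigD1 k) //= lerDl; apply: sumr_ge0 => m _.
  by have [] := pp.
have [c cA cmin] := EVT_min_rV A0 Ac (continuous_subspaceT fc).
have cA' : coupling p q (vec_mx c) by move: cA; rewrite inE.
have minc Q : coupling p q Q -> f c <= \tr (Q^T *m D).
  move=> cQ; have := cmin (mxvec Q); rewrite /f mxvecK; apply.
  by rewrite inE /A /= mxvecK.
have lb : lbound [set \tr (Q^T *m D) | Q in coupling p q] (f c).
  by move=> _ [Q cQ <-]; exact: minc.
have Wle Q : coupling p q Q -> wasserstein D p q <= \tr (Q^T *m D).
  by move=> cQ; apply: ge_inf; [exists (f c)|exists Q].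
split=> //; exists (vec_mx c) => //; apply/eqP; rewrite eq_le Wle// andbT.
by apply: lb_le_inf => //; exists (f c); exists (vec_mx c).
Qed.

End wasserstein.

Section subvector.
Context {M : nat} {d : 'I_M -> measure_display}
  (T : forall j, measurableType (d j)) (theta : {set 'I_M}).

Definition coordinates := forall j : {j | j \in theta}, T (val j).

Definition cylinders : set (set coordinates) :=
  [set A | exists (j : {j | j \in theta}) (B : set (T (val j))),
             measurable B /\ A = [set x | B (x j)]].

(* Values of the subvector indexed by theta, with the product
   sigma-algebra. *)
Definition config := g_sigma_algebraType cylinders.

Definition subvector {Omega : Type} (X : forall j, Omega -> T j) :
  Omega -> config := fun w j => X (val j) w.

End subvector.
Arguments subvector {M d T} theta {Omega} X.

(* kappa z is a version of the conditional distribution of Y given V = z,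
   fixed at every z. *)
Definition cond_distribution {R : realType} {dO dZ : measure_display}
    {Omega : measurableType dO} {Z : measurableType dZ}
    (P : probability Omega R) {n : nat} (Y : Omega -> 'I_n) (V : Omega -> Z)
    (kappa : Z -> 'cV[R]_n) : Prop :=
  [/\ forall z, prob_vector (kappa z),
      forall k, measurable_fun setT (fun z => kappa z k 0) &
      forall k (B : set Z), measurable B ->
        (\int[P]_(w in V @^-1` B) (kappa (V w) k 0)%:E =
         P (V @^-1` B `&` Y @^-1` [set k]))%E].

(* Main.v *)
Require Import Defs.
From mathcomp Require Import all_boot all_order all_algebra.
From mathcomp Require Import all_classical all_reals all_analysis.
Local Open Scope classical_set_scope.
Local Open Scope ring_scope.
Import Order.TTheory GRing.Theory Num.Theory.

Set Implicit Arguments.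
Unset Strict Implicit.

(** Both sides range over the same configurations, so it suffices that the distance separates
    probability vectors ([wasserstein_eq0]). The minimum over plans is attained, so distance zero
    yields a plan of cost zero; as [D] is positive off the diagonal, this plan moves nothing and its
    marginals coincide ([cost_eq0_marginals]). Conversely, between equal vectors the diagonal plan
    costs nothing ([coupling_diag], [cost_diag]). *)

Lemma cost_ge0 (R : realType) (n : nat) (D Q : 'M[R]_n) (p q : 'cV[R]_n) :
  ground_metric D -> coupling p q Q -> 0 <= \tr (Q^T *m D).
Proof.
move=> [D_ge0 _ _ _] [_ _ Q_ge0]; rewrite cost_sum.
by do 2![apply: sumr_ge0 => ? _]; exact: mulr_ge0.
Qed.

(** This is the plan that leaves all mass in place, the competitor that bounds the distance from [p]
    to itself by zero. *)
Lemma coupling_diag (R : realType) (n : nat) (p : 'cV[R]_n) :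
  prob_vector p -> coupling p p (diag_mx p^T).
Proof.
move=> [p_ge0 _]; have diag1 : diag_mx p^T *m const_mx 1 = p.
  by apply/matrixP => k j; rewrite mul_diag_mx !mxE mulr1 (ord1 j).
split=> //; first by rewrite tr_diag_mx.
by move=> k l; rewrite !mxE mulrn_wge0.
Qed.

Lemma cost_diag (R : realType) (n : nat) (D : 'M[R]_n) (v : 'rV[R]_n) :
  ground_metric D -> \tr ((diag_mx v)^T *m D) = 0.
Proof.
move=> [_ D_eq0 _ _]; rewrite tr_diag_mx mul_diag_mx.
by apply: big1 => k _; rewrite mxE (proj2 (D_eq0 k k) erefl) mulr0.
Qed.

(* A plan of zero cost moves no mass between distinct classes, so it is
   diagonal, hence symmetric, and its two marginals agree. *)
Lemma cost_eq0_marginals (R : realType) (n : nat) (D Q : 'M[R]_n)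
    (p q : 'cV[R]_n) :
  ground_metric D -> coupling p q Q -> \tr (Q^T *m D) = 0 -> p = q.
Proof.
move=> [D_ge0 D_eq0 _ _] [<- <- Q_ge0]; rewrite cost_sum => cost0.
have QD_ge0 k l : 0 <= Q k l * D k l by exact: mulr_ge0.
have QD_eq0 k l : Q k l * D k l = 0.
  have row0 : \sum_l Q k l * D k l = 0.
    apply: (psumr_eq0P _ cost0) => // k' _.
    exact: sumr_ge0.
  exact: (psumr_eq0P (fun l' _ => QD_ge0 k l') row0).
have offdiag k l : k <> l -> Q k l = 0.
  move=> kl; move/eqP: (QD_eq0 k l); rewrite mulf_eq0.
  by case/orP => [/eqP //|/eqP /(proj1 (D_eq0 k l))].
suff -> : Q^T = Q by [].
apply/matrixP => k l; rewrite mxE; have [-> //|/eqP kl] := eqVneq k l.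
by rewrite !offdiag//; exact: nesym.
Qed.

Lemma wasserstein_eq0 (R : realType) (n : nat) (D : 'M[R]_n) (p q : 'cV[R]_n) :
  ground_metric D -> prob_vector p -> prob_vector q ->
  wasserstein D p q = 0 <-> p = q.
Proof.
move=> metricD prob_p prob_q.
have [[Q couplQ costQ] W_le] := wasserstein_min D prob_p prob_q.
split=> [W0|pq]; first exact: cost_eq0_marginals (etrans costQ W0).
(* The lower bound holds because the distance is the cost of the optimal plan [Q]. *)
apply/eqP; rewrite eq_le -{2}costQ (cost_ge0 metricD couplQ) andbT.
(* For the upper bound, zero is rewritten as the cost of the diagonal plan, so that minimality
   applies. *)
rewrite -(cost_diag p^T metricD); apply: W_le.
by rewrite -pq; exact: coupling_diag.
Qed.

Unset Implicit Arguments.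
Set Strict Implicit.

Theorem proposition1 (R : realType)
    (dO : measure_display) (Omega : measurableType dO)
    (P : probability Omega R)
    (M : nat) (d : 'I_M -> measure_display)
    (T : forall j, measurableType (d j))
    (X : forall j, Omega -> T j) (mX : forall j, measurable_fun setT (X j))
    (n : nat) (Y : Omega -> 'I_n)
    (mY : forall k, measurable (Y @^-1` [set k]))
    (D : 'M[R]_n) (hD : ground_metric D)
    (i : 'I_M) (G : {set 'I_M}) (hi : i \notin G)
    (pXGi : config T G * T i -> 'cV[R]_n)
    (hpXGi : cond_distribution P Y (fun w => (subvector G X w, X i w)) pXGi)
    (pXG : config T G -> 'cV[R]_n)
    (hpXG : cond_distribution P Y (subvector G X) pXG)
    (C : set (config T G * T i)) :
  (forall (xG : config T G) (xi : T i), C (xG, xi) ->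
     pXGi (xG, xi) = pXG xG) <->
  (forall (xG : config T G) (xi : T i), C (xG, xi) ->
     wasserstein D (pXGi (xG, xi)) (pXG xG) = 0).
Proof.
(* The fixed versions are probability vectors at every point, so the equivalence holds at each
   configuration, with no exceptional null set. *)
have [prob_pXGi _ _] := hpXGi; have [prob_pXG _ _] := hpXG.
by split=> eq_pW xG xi Cx; apply/(wasserstein_eq0 hD) => //; exact: eq_pW.
Qed.
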